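(* Let $k$ be a positive integer. If $P\subseteq\mathbb{R}^2$ determines at most $k$ distinct $\ell^1$-distances, then $|P|\le (k+1)^2$. Further, $|P|=(k+1)^2$ if and only if $P$ is $\ell^1$-similar to $\Lambda_2(k)$.
   Context: For $x\in\mathbb{R}^d$, $\|x\|_1=\sum|x_i|$; the $\ell^1$-distance between $x,y$ is $\|x-y\|_1$. A set determines the distance $\lambda$ if $\lambda=\|x-y\|_1$ for two distinct points $x,y$ of the set ($0$ is not counted). $\Lambda_2(k)=\{(n_1,n_2)\in\mathbb{Z}^2: |n_1|+|n_2|\le k,\ n_1+n_2\equiv k\pmod 2\}$. Two subsets of $\mathbb{R}^d$ are $\ell^1$-similar if one can be mapped to the other by a composition of translations, reflections about coordinate hyperplanes, dilations (scalings by a positive factor), and coordinate permutations. *)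

(* Defs.v *)
From HB Require Import structures.
From mathcomp Require Import all_boot all_order all_algebra.
From mathcomp Require Import all_fingroup.
From mathcomp Require Import all_classical all_reals.

Set Implicit Arguments.
Unset Strict Implicit.
Unset Printing Implicit Defensive.

Import Order.TTheory GRing.Theory Num.Theory.
Local Open Scope classical_set_scope.
Local Open Scope ring_scope.

(* Stated over any numDomainType so that it applies both to real vectors and
   to the integer vectors used in Lambda2. The norm that MathComp-Analysis puts
   on matrices is the sup norm. *)
Definition l1norm (R : numDomainType) (d : nat) (x : 'rV[R]_d) : R :=
  \sum_(i < d) `|x 0 i|.

Definition l1dist (R : numDomainType) (d : nat) (x y : 'rV[R]_d) : R :=
  l1norm (x - y).

Definition l1distances (R : realType) (d : nat) (P : set 'rV[R]_d) : set R :=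
  [set l | exists x y, [/\ P x, P y, x <> y & l = l1dist x y]].

Definition Lambda2 (R : realType) (k : nat) : set 'rV[R]_2 :=
  [set map_mx intr n | n in
    [set n : 'rV[int]_2 |
      l1norm n <= k%:Z /\ ((n 0 0 + n 0 1)%R = k%:Z %[mod 2])%Z]].
Arguments Lambda2 : clear implicits.

Definition reflect_coord (R : realType) (d : nat) (i : 'I_d) (x : 'rV[R]_d) :
    'rV[R]_d :=
  \row_j (if j == i then - x 0 j else x 0 j).

Inductive l1similarity (R : realType) (d : nat) :
    ('rV[R]_d -> 'rV[R]_d) -> Prop :=
| l1sim_translation (v : 'rV[R]_d) : l1similarity (fun x => x + v)
| l1sim_reflection (i : 'I_d) : l1similarity (reflect_coord i)
| l1sim_dilation (c : R) of 0 < c : l1similarity (fun x => c *: x)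
| l1sim_permutation (s : 'S_d) : l1similarity (fun x => col_perm s x)
| l1sim_comp (f g : 'rV[R]_d -> 'rV[R]_d) of l1similarity f & l1similarity g :
    l1similarity (g \o f).

Definition l1similar (R : realType) (d : nat) (A B : set 'rV[R]_d) : Prop :=
  exists f : 'rV[R]_d -> 'rV[R]_d, l1similarity f /\ f @` A = B.

(* Main.v *)
(** In the coordinates [x0 + x1] and [x0 - x1] the l1-distance is the maximum of
    the two coordinate differences, and [Lambda2 k] is a (k+1) x (k+1) grid.
    Order P by "q lies in the right quadrant cone of p", and likewise with the
    upper cone: two distinct points are comparable in at least one of the two
    orders.  Along a chain, the distances to one end are pairwise distinct, so
    both height functions take values in {0, ..., k}, and together they are
    injective; hence the bound.  In the case of equality all pairs of heights
    occur, and the points with a fixed height in one order form a chain of k+1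
    points in the other, which realises all k distances.  This determines the
    steps along each row and column, forces them to be equal, and the bound on
    the diameter aligns the rows and the columns. *)

Require Import Defs.
From HB Require Import structures.
From mathcomp Require Import all_boot all_order all_algebra.
From mathcomp Require Import all_fingroup.
From mathcomp Require Import all_classical all_reals.
From mathcomp Require Import zify ring lra.

Set Implicit Arguments.
Unset Strict Implicit.
Unset Printing Implicit Defensive.

Import Order.TTheory GRing.Theory Num.Theory.
Local Open Scope classical_set_scope.
Local Open Scope card_scope.
Local Open Scope ring_scope.

(** * Counting in sets with at most [k] elements *)

Lemma card_le_II_size (T : choiceType) (D : set T) (k : nat) (s : seq T) :
  D #<= `I_k -> uniq s -> (forall x, x \in s -> D x) -> (size s <= k)%N.
Proof.
move=> hD us sD; apply: leq_trans (geq_card_fset_set hD).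
apply: uniq_leq_size => // x xs.
by rewrite in_fset_set ?inE; [exact: sD | apply/finite_set_leP; exists k].
Qed.

Lemma sub_II_card_eq (S : set nat) (n : nat) :
  S `<=` `I_n -> S #= `I_n -> S = `I_n.
Proof.
move=> Sn hS; apply/seteqP; split=> // m /= mn.
have fS : finite_set S by apply/finite_setP; exists n.
have [||_ eqS] := @uniq_min_size _ (finmap.enum_fset (fset_set S)) (iota 0 n)
    (finmap.fset_uniq _).
- by move=> x; rewrite in_fset_set ?inE// mem_iota => /Sn.
- by rewrite size_iota (card_fset_set hS).
- by have := eqS m; rewrite mem_iota/= add0n mn in_fset_set// => /set_mem.
Qed.

(** An element of [s] missing from [t] would give k+1 elements of [D]. So both lists exhaust [D],
    and sorting leaves only one order. *)
Lemma lt_sorted_in_card_le_II (R : realType) (D : set R) (k : nat) (s t : seq R) :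
  D #<= `I_k -> sorted <%R s -> sorted <%R t -> size s = k -> size t = k ->
  (forall x, x \in s -> D x) -> (forall x, x \in t -> D x) -> s = t.
Proof.
move=> hD ss st sk tk sD tD; apply: lt_sorted_eq => //.
have [||//] := @uniq_min_size _ s t (lt_sorted_uniq ss).
  move=> x xs; apply/negP => /negP xt.
  have : (size (x :: t) <= k)%N.
    apply: (card_le_II_size hD) => /=; first by rewrite xt lt_sorted_uniq.
    by move=> y; rewrite inE => /predU1P[->|]; [exact: sD | exact: tD].
  by rewrite /= tk ltnn.
by rewrite sk tk.
Qed.

(** * Cone orders and heights *)

Section Cone.
Variables (R : realType) (T : choiceType) (X Y : T -> R).

(** A strict order; exchanging [X] and [Y] turns the right quadrant cone into the upper one. *)
Definition cone (p q : T) : bool := (X p < X q) && (`|Y q - Y p| <= X q - X p).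

Lemma cone_trans : transitive cone.
Proof.
move=> q p r /andP[h1 h2] /andP[h3 h4]; apply/andP; split; first lra.
by rewrite (_ : Y r - Y p = (Y r - Y q) + (Y q - Y p));
  [apply: le_trans (ler_normD _ _) _; lra | ring].
Qed.

Variables (P : set T) (D : set R) (k : nat).
Hypothesis cardD : D #<= `I_k.
Hypothesis coneD : forall p q, P p -> P q -> cone p q -> D (X q - X p).

Definition chain_below (p : T) (s : seq T) : Prop :=
  (forall q, q \in s -> P q) /\ path (fun a b => cone b a) p s.

(** By transitivity every member of [s] lies in the cone order below [p], so the differences
    [X p - X q] belong to [D]; they strictly increase along [s]. *)
Lemma size_chain_below p s : P p -> chain_below p s -> (size s <= k)%N.
Proof.
move=> Pp [sP ps]; rewrite -(size_map (fun q => X p - X q)).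
apply: (card_le_II_size cardD).
  apply: lt_sorted_uniq.
  apply: homo_sorted (path_sorted ps) => a b /andP[h _]; lra.
have rtr : transitive (fun a b => cone b a).
  by move=> b a c h1 h2; exact: cone_trans h2 h1.
move=> x /mapP[q qs ->]; apply: coneD => //; first exact: sP.
by have /allP := order_path_min rtr ps; apply.
Qed.

(** The empty chain always qualifies. For [p] in [P], the cut-off at [k] loses no chain, by
    [size_chain_below]. *)
Definition height (p : T) : nat :=
  (\max_(n < k.+1 | `[< exists2 s, size s = n & chain_below p s >]) n)%N.

Lemma height_le p : (height p <= k)%N.
Proof. by apply/bigmax_leqP => i _; rewrite -ltnS. Qed.

Lemma height_lt p q : P p -> P q -> cone p q -> (height p < height q)%N.
Proof.
move=> Pp Pq pq.
have [|n /asboolP[s sn [sP ps]] hn] := @eq_bigmax_cond 'I_k.+1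
    (fun n => `[< exists2 s, size s = n & chain_below p s >]) (fun n => n : nat).
  apply/card_gt0P; exists ord0; apply/asboolP.
  by exists [::] => //; split.
(* A longest chain below [p] becomes a longer one below [q] once [p] is put in front. *)
have cs : chain_below q (p :: s).
  split; last by rewrite /= pq.
  by move=> r; rewrite inE => /predU1P[->|/sP].
have := size_chain_below Pq cs => /= nk; rewrite sn -ltnS in nk.
rewrite /height hn.
apply: (@leq_bigmax_cond _ _ (fun n : 'I_k.+1 => n : nat) (Ordinal nk)).
by apply/asboolP; exists (p :: s); rewrite //= sn.
Qed.

End Cone.

(** The coordinate with the larger absolute difference decides which cone applies. *)
Lemma cone_total (R : realType) (T : choiceType) (X Y : T -> R) (p q : T) :
  (X p != X q) || (Y p != Y q) ->
  [|| cone X Y p q, cone X Y q p, cone Y X p q | cone Y X q p].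
Proof.
by rewrite /cone !ler_norml !neq_lt; lra.
Qed.

(** * Sequences of k+1 reals whose differences all lie in a set of at most [k] elements *)

Section Ladder.
Variables (R : realType) (D : set R) (k : nat).
Hypothesis cardD : D #<= `I_k.

Lemma increasing_in_unique (f g : nat -> R) :
  (forall i, (i.+1 < k)%N -> f i < f i.+1) -> (forall i, (i < k)%N -> D (f i)) ->
  (forall i, (i.+1 < k)%N -> g i < g i.+1) -> (forall i, (i < k)%N -> D (g i)) ->
  forall i, (i < k)%N -> f i = g i.
Proof.
move=> fS fD gS gD i ik.
have sortedM (h : nat -> R) : (forall i, (i.+1 < k)%N -> h i < h i.+1) ->
    sorted <%R (mkseq h k).
  move=> hS; apply/(sortedP 0) => m; rewrite size_mkseq => mk.
  by rewrite !nth_mkseq ?hS // ltnW.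
have inM (h : nat -> R) : (forall i, (i < k)%N -> D (h i)) ->
    forall x, x \in mkseq h k -> D x.
  by move=> hD x /mapP[m]; rewrite mem_iota => mk ->; exact: hD.
have /(congr1 (nth 0 ^~ i)) : mkseq f k = mkseq g k.
  by apply: (lt_sorted_in_card_le_II cardD);
    rewrite ?size_mkseq; do ?[exact: sortedM | exact: inM].
by rewrite !nth_mkseq.
Qed.

Definition ladder (u : nat -> R) : Prop :=
  forall i j, (i < j <= k)%N -> u i < u j /\ D (u j - u i).

Lemma ladder_unique u v i : ladder u -> ladder v -> (i <= k)%N ->
  u i - u 0%N = v i - v 0%N.
Proof.
move=> hu hv; case: i => [|i ik]; first by rewrite !subrr.
apply: (@increasing_in_unique (fun i => u i.+1 - u 0%N)
  (fun i => v i.+1 - v 0%N)) => // j jk; first [exact: (hu 0%N j.+1 _).2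
  | exact: (hv 0%N j.+1 _).2 | idtac].
- by rewrite ltrD2r; apply: (hu _ _ _).1; lia.
- by rewrite ltrD2r; apply: (hv _ _ _).1; lia.
Qed.

(* Measured from [u 1] instead of [u 0], the ladder again realises all the
   distances but the largest one, hence it is an arithmetic progression. *)
Lemma ladder_arith u i : ladder u -> (i <= k)%N ->
  u i = u 0%N + (u 1%N - u 0%N) * i%:R.
Proof.
move=> hu; elim: i => [_|i IH ik]; first by rewrite mulr0 addr0.
case: i => [|i] in IH ik *; first by rewrite mulr1; ring.
have := IH (ltnW ik); rewrite -[in X in _ -> X]natr1 => {}IH.
suff : u i.+1 - u 0%N = u i.+2 - u 1%N by lra.
(* The differences from [u 1] number only k-1; the overall largest difference fills the last place,
   so that [g] also enumerates [D]. *)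
pose g j := if (j.+1 < k)%N then u j.+2 - u 1%N else u k - u 0%N.
have -> : u i.+2 - u 1%N = g i by rewrite /g ik.
apply: (@increasing_in_unique (fun i => u i.+1 - u 0%N) g); last by lia.
- by move=> j jk; rewrite ltrD2r; apply: (hu _ _ _).1; lia.
- by move=> j jk; apply: (hu _ _ _).2; lia.
- move=> j jk; rewrite /g jk; case: ifP => jk2.
    by rewrite ltrD2r; apply: (hu _ _ _).1; lia.
  have -> : k = j.+2 by lia.
  by rewrite ltrD2l ltrN2; apply: (hu _ _ _).1; lia.
- by move=> j jk; rewrite /g; case: ifP => ?; apply: (hu _ _ _).2; lia.
Qed.

Lemma ladder_max u x : ladder u -> D x -> x <= u k - u 0%N.
Proof.
move=> hu Dx; rewrite leNgt; apply/negP => xu.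
have uk j : (j <= k)%N -> u j <= u k.
  by rewrite leq_eqVlt => /predU1P[->//|jk]; apply/ltW/(hu _ _ _).1; lia.
(* The [k] differences from [u 0], followed by the still larger [x], would be k+1 elements of
   [D]. *)
suff : (size (mkseq (fun i => if i == k then x else (u i.+1 - u 0%N)%R) k.+1) <= k)%N.
  by rewrite size_mkseq ltnn.
apply: (card_le_II_size cardD).
  apply: lt_sorted_uniq; apply/(sortedP 0) => m; rewrite size_mkseq => mk.
  rewrite !nth_mkseq//; last exact: ltnW.
  have -> : (m == k) = false by lia.
  case: ifP => [_|mk'].
    by apply: le_lt_trans xu; rewrite lerD2r uk.
  by rewrite ltrD2r; apply: (hu _ _ _).1; lia.
move=> y /mapP[m]; rewrite mem_iota => mk ->; case: ifP => // mk'.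
by apply: (hu _ _ _).2; lia.
Qed.

End Ladder.

(** * The bound, and the grid structure in the extremal case *)

Section Grid.
Variables (R : realType) (T : choiceType) (X Y : T -> R).
Variables (P : set T) (D : set R) (k : nat).
Hypothesis cardD : D #<= `I_k.
Hypothesis XYinj : forall p q, X p = X q -> Y p = Y q -> p = q.
Hypothesis coneXD : forall p q, P p -> P q -> cone X Y p q -> D (X q - X p).
Hypothesis coneYD : forall p q, P p -> P q -> cone Y X p q -> D (Y q - Y p).

Let hX := height X Y P k.
Let hY := height Y X P k.

Let hX_le p : (hX p <= k)%N. Proof. exact: height_le. Qed.
Let hY_le p : (hY p <= k)%N. Proof. exact: height_le. Qed.

Let comparable p q : p != q ->
  [|| cone X Y p q, cone X Y q p, cone Y X p q | cone Y X q p].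
Proof.
move=> pq; apply: cone_total; rewrite -negb_and; apply: contra pq.
by move=> /andP[/eqP h1 /eqP h2]; apply/eqP/XYinj.
Qed.

Lemma heights_inj p q : P p -> P q -> hX p = hX q -> hY p = hY q -> p = q.
Proof.
move=> Pp Pq eX eY; apply/eqP; apply: contraT => /comparable.
by case/or4P => /[dup] c;
  [move/(height_lt cardD coneXD Pp Pq) | move/(height_lt cardD coneXD Pq Pp)
  |move/(height_lt cardD coneYD Pp Pq) | move/(height_lt cardD coneYD Pq Pp)];
  rewrite -?/hX -?/hY; lia.
Qed.

(** The two heights are the digits of a number in base k+1. *)
Let code p := (hX p * k.+1 + hY p)%N.

Let codeK m i j : (j <= k)%N -> m = (i * k.+1 + j)%N ->
  i = (m %/ k.+1)%N /\ j = (m %% k.+1)%N.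
Proof. by move=> jk ->; rewrite divnMDl// modnMDl divn_small// addn0 modn_small. Qed.

Let code_inj : {in P &, injective code}.
Proof.
move=> p q /set_mem Pp /set_mem Pq e.
have [e1 e2] := codeK (hY_le p) (erefl (code p)).
have [e3 e4] := codeK (hY_le q) e.
by apply: heights_inj => //; [rewrite e1 -e3|rewrite e2 -e4].
Qed.

Let code_sub : code @` P `<=` `I_(k.+1 ^ 2).
Proof.
move=> _ [p Pp <-] /=; rewrite /code.
have := hX_le p; have := hY_le p.
by nia.
Qed.

Lemma card_le_grid : P #<= `I_(k.+1 ^ 2).
Proof.
by rewrite -(card_le_eql (inj_card_eq code_inj)); exact: subset_card_le.
Qed.

Lemma card_eq_grid : (0 < k)%N -> P #= `I_(k.+1 ^ 2) ->
  exists a b c, 0 < c /\ forall p, P p <->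
    exists i j : nat, [/\ (i <= k)%N, (j <= k)%N,
      X p = a + c * i%:R & Y p = b + c * j%:R].
Proof.
move=> k0 cardP.
have codeE : code @` P = `I_(k.+1 ^ 2).
  apply: sub_II_card_eq => //.
  exact: card_eq_trans (inj_card_eq code_inj) cardP.
have [p0 _ _] : (code @` P) 0%N by rewrite codeE.
(* [e (i, j)] is the point of [P] with heights [i] and [j]; outside the range [p0] is a dummy
   value. *)
have /choice[e he] : forall ij : nat * nat, exists p,
    (ij.1 <= k)%N -> (ij.2 <= k)%N -> [/\ P p, hX p = ij.1 & hY p = ij.2].
  move=> [i j] /=.
  have [ik|] := leqP i k; last by exists p0.
  have [jk|] := leqP j k; last by exists p0.
  have : `I_(k.+1 ^ 2) (i * k.+1 + j)%N by rewrite /=; nia.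
  rewrite -codeE => -[p Pp e]; exists p => _ _.
  have [e1 e2] := codeK (hY_le p) (erefl (code p)).
  have [e3 e4] := codeK jk e.
  by split=> //; [rewrite e1 -e3|rewrite e2 -e4].
have eP i j : (i <= k)%N -> (j <= k)%N -> P (e (i, j)).
  by move=> ik jk; have [] := he (i, j) ik jk.
have eX i j : (i <= k)%N -> (j <= k)%N -> hX (e (i, j)) = i.
  by move=> ik jk; have [] := he (i, j) ik jk.
have eY i j : (i <= k)%N -> (j <= k)%N -> hY (e (i, j)) = j.
  by move=> ik jk; have [] := he (i, j) ik jk.
(* Each cone relation comes with the inequality of heights that it forces. Between points that share
   one index, only the order of the other index survives. *)
have cmp i j i' j' : (i <= k)%N -> (j <= k)%N -> (i' <= k)%N -> (j' <= k)%N ->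
    (i, j) != (i', j') ->
    [|| cone X Y (e (i, j)) (e (i', j')) && (i < i')%N,
      cone X Y (e (i', j')) (e (i, j)) && (i' < i)%N,
      cone Y X (e (i, j)) (e (i', j')) && (j < j')%N |
      cone Y X (e (i', j')) (e (i, j)) && (j' < j)%N].
  move=> ik jk i'k j'k ne.
  have {ne} : e (i, j) != e (i', j').
    apply: contra ne => /eqP ee; apply/eqP; congr pair.
      by rewrite -(eX _ _ ik jk) ee eX.
    by rewrite -(eY _ _ ik jk) ee eY.
  have Pp := eP _ _ ik jk; have Pq := eP _ _ i'k j'k.
  move/comparable; case/or4P => c; apply/or4P;
    [apply: Or41|apply: Or42|apply: Or43|apply: Or44]; rewrite c /=;
    [have := height_lt cardD coneXD Pp Pq c|have := height_lt cardD coneXD Pq Pp c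
    |have := height_lt cardD coneYD Pp Pq c|have := height_lt cardD coneYD Pq Pp c];
    by rewrite -?/hX -?/hY ?eX ?eY.
have row i : (i <= k)%N -> ladder D k (fun j => Y (e (i, j))).
  move=> ik j j' jj'.
  have := cmp i j i j' ik _ ik _; rewrite !ltnn !andbF/= xpair_eqE eqxx/=.
  have -> : (j' < j)%N = false by lia.
  rewrite andbF orbF => /(_ _ _ _)/andP[]; try lia.
  move=> c _; split; first by case/andP: c.
  by apply: coneYD => //; apply: eP => //; lia.
have col j : (j <= k)%N -> ladder D k (fun i => X (e (i, j))).
  move=> jk i i' ii'.
  have := cmp i j i' j _ jk _ jk; rewrite !ltnn !andbF/= xpair_eqE eqxx/= andbT.
  have -> : (i' < i)%N = false by lia.
  rewrite andbF !orbF => /(_ _ _ _)/andP[]; try lia.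
  move=> c _; split; first by case/andP: c.
  by apply: coneXD => //; apply: eP => //; lia.
(* Row 0 serves as reference: by [ladder_unique] all rows and columns have the increments of [u]. *)
pose u j := Y (e (0%N, j)); have hu : ladder D k u by exact: row.
pose M := u k - u 0%N.
have M0 : 0 < M by rewrite subr_gt0; apply: (hu _ _ _).1; lia.
(* Comparability bounds both coordinate differences by a single element of [D], and [ladder_max]
   bounds that by [M]. *)
have diam p q : P p -> P q -> X q - X p <= M /\ Y q - Y p <= M.
  move=> Pp Pq; have [->|/comparable] := eqVneq p q; first by rewrite !subrr; lra.
  case/or4P => /[dup] /andP[]; rewrite ler_norml => c1 c2;
  [move/(coneXD Pp Pq)|move/(coneXD Pq Pp)|move/(coneYD Pp Pq)|move/(coneYD Pq Pp)];
  move/(ladder_max cardD hu); rewrite -/M; lra.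
have Ycol i j : (i <= k)%N -> (j <= k)%N ->
    Y (e (i, j)) - Y (e (i, 0%N)) = u j - u 0%N.
  by move=> ik jk; exact: (ladder_unique cardD (row _ ik) hu jk).
have Xrow i j : (i <= k)%N -> (j <= k)%N ->
    X (e (i, j)) - X (e (0%N, j)) = u i - u 0%N.
  by move=> ik jk; exact: (ladder_unique cardD (col _ jk) hu ik).
(* The diameter is attained across every row and every column, which leaves no
   room for the rows or the columns to be shifted against each other. *)
have Xc j j' : (j <= k)%N -> (j' <= k)%N -> X (e (0%N, j)) <= X (e (0%N, j')).
  move=> jk j'k; have [h _] := diam _ _ (eP 0%N j' isT j'k) (eP k j (leqnn k) jk).
  by have := Xrow k j (leqnn k) jk; rewrite -/M; lra.
have Yc i i' : (i <= k)%N -> (i' <= k)%N -> Y (e (i, 0%N)) <= Y (e (i', 0%N)).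
  move=> ik i'k; have [_ h] := diam _ _ (eP i' 0%N i'k isT) (eP i k ik (leqnn k)).
  by have := Ycol i k ik (leqnn k); rewrite -/M; lra.
exists (X (e (0%N, 0%N))), (Y (e (0%N, 0%N))), (u 1%N - u 0%N).
have coords i j : (i <= k)%N -> (j <= k)%N ->
    X (e (i, j)) = X (e (0%N, 0%N)) + (u 1%N - u 0%N) * i%:R /\
    Y (e (i, j)) = Y (e (0%N, 0%N)) + (u 1%N - u 0%N) * j%:R.
  move=> ik jk.
  have ui := ladder_arith cardD hu ik; have uj := ladder_arith cardD hu jk.
  have := Xrow _ _ ik jk; have := Ycol _ _ ik jk.
  have := Xc _ _ jk (leq0n k); have := Xc _ _ (leq0n k) jk.
  have := Yc _ _ ik (leq0n k); have := Yc _ _ (leq0n k) ik.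
  by rewrite ui uj; lra.
split; first by rewrite subr_gt0; apply: (hu _ _ _).1; lia.
move=> p; split=> [Pp|[i [j [ik jk xp yp]]]].
  have ik := hX_le p; have jk := hY_le p.
  have [h1 h2] := coords _ _ ik jk.
  exists (hX p), (hY p); split=> //.
    by rewrite -h1; congr X; apply: heights_inj; rewrite ?eX ?eY //; exact: eP.
  by rewrite -h2; congr Y; apply: heights_inj; rewrite ?eX ?eY //; exact: eP.
have [h1 h2] := coords _ _ ik jk.
by rewrite (XYinj (etrans xp (esym h1)) (etrans yp (esym h2))); exact: eP.
Qed.

End Grid.

(** * The plane in rotated coordinates *)

Section Plane.
Variable R : realType.
Implicit Types p q : 'rV[R]_2.

Definition diag p : R := p 0 0 + p 0 1.
Definition antidiag p : R := p 0 0 - p 0 1.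

Lemma row2P p q : p 0 0 = q 0 0 -> p 0 1 = q 0 1 -> p = q.
Proof.
move=> h0 h1; apply/rowP => i; have [->//|i1] := eqVneq i 0.
by have -> : i = 1 by apply/val_inj; case: i i1 => -[|[|]].
Qed.

Lemma l1norm2 (S : numDomainType) (x : 'rV[S]_2) : l1norm x = `|x 0 0| + `|x 0 1|.
Proof.
rewrite /l1norm big_ord_recl big_ord1; congr (_ + `|x _ _|).
exact: val_inj.
Qed.

Lemma diag_inj p q : diag p = diag q -> antidiag p = antidiag q -> p = q.
Proof. by rewrite /diag /antidiag => h1 h2; apply: row2P; lra. Qed.

Lemma cone_diag_dist p q : cone diag antidiag p q -> l1dist q p = diag q - diag p.
Proof.
rewrite /cone /l1dist l1norm2 !mxE ler_norml /diag /antidiag => /andP[h1 h2].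
by rewrite !ger0_norm; lra.
Qed.

Lemma cone_antidiag_dist p q :
  cone antidiag diag p q -> l1dist q p = antidiag q - antidiag p.
Proof.
rewrite /cone /l1dist l1norm2 !mxE ler_norml /diag /antidiag => /andP[h1 h2].
by rewrite (ger0_norm (x := q 0 0 - p 0 0)) ?(ler0_norm (x := q 0 1 - p 0 1)); lra.
Qed.

Lemma cone_neq (X Y : 'rV[R]_2 -> R) p q : cone X Y p q -> q <> p.
Proof. by move=> /andP[h _] e; rewrite e ltxx in h. Qed.

Lemma parity_coords (x y : int) (k : nat) :
  `|x| + `|y| <= k%:Z -> (x + y = k%:Z %[mod 2])%Z ->
  exists i j : nat, [/\ (i <= k)%N, (j <= k)%N,
    x + y = 2 * i%:Z - k%:Z & x - y = 2 * j%:Z - k%:Z].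
Proof.
move=> hn hm.
have [m hm'] : exists m : int, x + y + k%:Z = 2 * m.
  by exists ((x + y + k%:Z) %/ 2)%Z; lia.
(* Both [m] and [m - y] are nonnegative by the norm bound; the absolute values only convert them to
   [nat]. *)
by exists `|m|%N, `|m - y|%N; split; lia.
Qed.

(** In rotated coordinates the parity condition disappears: what remains is a square grid of step 2
    centred at the origin. *)
Lemma Lambda2E k q : Lambda2 R k q <-> exists i j : nat,
  [/\ (i <= k)%N, (j <= k)%N, diag q = 2 * i%:R - k%:R & antidiag q = 2 * j%:R - k%:R].
Proof.
split=> [[n [hn hm] <-]|[i [j [ik jk hX hY]]]].
  rewrite l1norm2 in hn.
  have [i [j [ik jk hX hY]]] := parity_coords hn hm.
  exists i, j; split=> //.
    by rewrite /diag !mxE -intrD hX intrB intrM.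
  by rewrite /antidiag !mxE -intrB hY intrB intrM.
pose n : 'rV[int]_2 := \row_t (if t == 0 then i%:Z + j%:Z - k%:Z else i%:Z - j%:Z).
have n0 : n 0 0 = i%:Z + j%:Z - k%:Z by rewrite mxE.
have n1 : n 0 1 = i%:Z - j%:Z by rewrite mxE.
exists n; first by rewrite /= l1norm2 n0 n1; split; lia.
by apply: diag_inj; rewrite ?hX ?hY /diag /antidiag ![map_mx _ _ _ _]mxE n0 n1
  ?intrB ?intrD -!pmulrn; lra.
Qed.

Lemma card_Lambda2 k : Lambda2 R k #= `I_(k.+1 ^ 2).
Proof.
pose g m : 'rV[R]_2 := \row_t (if t == 0 then (m %/ k.+1 + m %% k.+1)%:R - k%:R
  else (m %/ k.+1)%:R - (m %% k.+1)%:R).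
have gX m : diag (g m) = 2 * (m %/ k.+1)%:R - k%:R.
  by rewrite /diag !mxE /= natrD; ring.
have gY m : antidiag (g m) = 2 * (m %% k.+1)%:R - k%:R.
  by rewrite /antidiag !mxE /= natrD; ring.
have -> : Lambda2 R k = g @` `I_(k.+1 ^ 2).
  apply/seteqP; split=> [q /Lambda2E[i [j [ik jk hX hY]]]|_ [m /= mk <-]].
    exists (i * k.+1 + j)%N; first by rewrite /=; nia.
    by apply: diag_inj; rewrite ?gX ?gY ?hX ?hY ?divnMDl//
      ?modnMDl ?divn_small ?modn_small ?addn0.
  apply/Lambda2E; exists (m %/ k.+1)%N, (m %% k.+1)%N; split=> //.
    by rewrite -ltnS ltn_divLR// mulnn.
  by rewrite -ltnS ltn_mod.
apply: inj_card_eq => m m' _ _ e.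
have := gX m; have := gY m; rewrite e gX gY => hY hX.
rewrite (divn_eq m k.+1) (divn_eq m' k.+1).
have /eqP : ((m' %/ k.+1)%:R = (m %/ k.+1)%:R :> R) by lra.
have /eqP : ((m' %% k.+1)%:R = (m %% k.+1)%:R :> R) by lra.
by rewrite !eqr_nat => /eqP -> /eqP ->.
Qed.

(** Lets cardinality be carried back from [Lambda2] to a similar set. *)
Lemma l1similarity_inj d (f : 'rV[R]_d -> 'rV[R]_d) : l1similarity f -> injective f.
Proof.
elim=> [v|i|c c0|s|{}f g _ If _ Ig] x y.
- exact: addIr.
- move=> /rowP e; apply/rowP => j; have := e j; rewrite !mxE.
  by case: eqP => // _ /oppr_inj.
- by apply: scalerI; rewrite gt_eqF.
- by move=> /(congr1 (col_perm s^-1%g)); rewrite -!col_permM mulVg !col_perm1.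
- by move=> /Ig /If.
Qed.

End Plane.

Theorem theorem2p5 (R : realType) (k : nat) (hk : (0 < k)%N)
    (P : set 'rV[R]_2) (hP : l1distances P #<= `I_k) :
  P #<= `I_(k.+1 ^ 2)%N /\
  (P #= `I_(k.+1 ^ 2)%N <-> l1similar P (Lambda2 R k)).
Proof.
have coneXD p q : P p -> P q -> cone (@diag R) (@antidiag R) p q ->
    l1distances P (diag q - diag p).
  move=> Pp Pq c; exists q, p; split=> //.
    exact: cone_neq c.
  by rewrite cone_diag_dist.
have coneYD p q : P p -> P q -> cone (@antidiag R) (@diag R) p q ->
    l1distances P (antidiag q - antidiag p).
  move=> Pp Pq c; exists q, p; split=> //.
    exact: cone_neq c.
  by rewrite cone_antidiag_dist.
split; first exact: card_le_grid hP (@diag_inj R) coneXD coneYD.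
split=> [cardP|[f [sf fP]]]; last first.
  have fI : {in P &, injective f} by move=> x y _ _; exact: l1similarity_inj.
  by rewrite -(card_eql (inj_card_eq fI)) fP; exact: card_Lambda2.
have [a [b [c [c0 gridP]]]] :=
  card_eq_grid hP (@diag_inj R) coneXD coneYD hk cardP.
(* The grid has centre [a + c * k / 2], [b + c * k / 2] in rotated coordinates; [v] moves it to the
   origin, and scaling by [2 / c] then turns step [c] into step 2. *)
pose v : 'rV[R]_2 :=
  \row_t (if t == 0 then - (a + b + c * k%:R) / 2 else (b - a) / 2).
exists ((fun x => (2 / c) *: x) \o (fun x => x + v)); split.
  by apply: l1sim_comp (l1sim_translation v) (l1sim_dilation _ _); rewrite divr_gt0.
have fX p : diag ((2 / c) *: (p + v)) = 2 / c * (diag p - a) - k%:R.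
  by rewrite /diag !mxE /=; field; rewrite gt_eqF.
have fY p : antidiag ((2 / c) *: (p + v)) = 2 / c * (antidiag p - b) - k%:R.
  by rewrite /antidiag !mxE /=; field; rewrite gt_eqF.
apply/seteqP; split=> [_ [p /gridP[i [j [ik jk hX hY]]] <-]|q].
  apply/Lambda2E; exists i, j; split=> //=.
    by rewrite fX hX; field; rewrite gt_eqF.
  by rewrite fY hY; field; rewrite gt_eqF.
move=> /Lambda2E[i [j [ik jk hX hY]]].
exists ((c / 2) *: q - v); last first.
  rewrite /= subrK scalerA (_ : 2 / c * (c / 2) = 1) ?scale1r //.
  by field; rewrite gt_eqF.
apply/gridP; exists i, j; split=> //.
  have -> : diag ((c / 2) *: q - v) = c / 2 * diag q - diag v.
    by rewrite /diag !mxE; ring.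
  by rewrite hX /diag !mxE /=; field.
have -> : antidiag ((c / 2) *: q - v) = c / 2 * antidiag q - antidiag v.
  by rewrite /antidiag !mxE; ring.
by rewrite hY /antidiag !mxE /=; field.
Qed.
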